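(* For every integer $r\ge 1$ there are two finite connected simple undirected graphs $G_r^-$ and $G_r^+$, each equipped with three marked vertices $s,u,v$, such that $uv$ is a nonedge in both graphs, the radius-$r$ local data of $(G_r^-;s,u,v)$ and $(G_r^+;s,u,v)$ are isomorphic (as marked, ambient-degree-labelled graphs), and $$\delta_s(G_r^+;uv)>0>\delta_s(G_r^-;uv).$$ Moreover the two configurations can be chosen so that, in both of them, $$d_s=d_u=d_v=1,\qquad \operatorname{dist}(s,\{u,v\})=2,\qquad R_{uv}=2.$$
   Context: For a finite connected simple undirected graph $G$ and a vertex $s$, $t_{\rm cov}(G,s)=\mathbb E_s\tau_{\rm cov}$ is the expected cover time of simple random walk on $G$ started at $s$, where $\tau_{\rm cov}$ is the first time at which every vertex of $G$ has been visited (the starting vertex counts as visited at time $0$). For a nonedge $uv$ of $G$, $G+uv$ is the graph with the edge $uv$ added, and $$\delta_s(G;uv)=t_{\rm cov}(G+uv,s)-t_{\rm cov}(G,s).$$ The radius-$r$ local datum of $(G;s,u,v)$ is the isomorphism class of the induced subgraph of $G$ on the vertices at distance at most $r$ from $\{s,u,v\}$, with $s,u,v$ individually marked (an isomorphism must send $s$ to $s$, $u$ to $u$, $v$ to $v$) and with every vertex of this subgraph labelled by its degree in the full graph $G$ (an isomorphism must preserve these labels). $d_x$ is the degree of $x$ in the graph before insertion, $\operatorname{dist}$ is graph distance before insertion, and $R_{uv}$ is the effective resistance between $u$ and $v$ in the graph before insertion, with every edge a unit resistor. The two graphs are not required to have the same number of vertices. *)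

(* Defs.v *)
From HB Require Import structures.
From mathcomp Require Import all_boot all_order all_algebra.
From mathcomp Require Import boolp classical_sets reals ereal topology normedtype sequences.

Set Implicit Arguments.
Unset Strict Implicit.
Unset Printing Implicit Defensive.

Import Order.TTheory GRing.Theory Num.Theory.

Record sgraph := SGraph {
  vertex :> finType;
  adj : rel vertex;
  adj_sym : symmetric adj;
  adj_irr : irreflexive adj }.

Arguments adj {s} : rename.

Section Graphs.
Variable G : sgraph.
Implicit Types (x y u v : G) (A : {set G}).

Definition graph_connected := forall x y, connect adj x y.

Definition nonedge u v := (u != v) && ~~ adj u v.

Definition deg x := #|[set y | adj x y]|.

Definition walk_of_length n x y :=
  [exists p : n.-tuple G, path adj x p && (last x p == y)].

(* The least length of a walk from x to y. A shortest walk has length less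
   than #|G|, so the search is exhaustive; the value is #|G| when y is not
   reachable from x. *)
Definition gdist x y :=
  find (fun n => walk_of_length n x y) (iota 0 #|G|).

(* gdist never exceeds #|G|, so the default value of the minimum is
   irrelevant when A is nonempty. *)
Definition gdist_set x A := \big[Order.min/#|G|]_(a in A) gdist x a.

Definition add_adj u v : rel G :=
  [rel x y | adj x y || (x != y) && ([set x; y] == [set u; v])].

Lemma add_adj_sym u v : symmetric (add_adj u v).
Proof. by move=> x y; rewrite /add_adj /= adj_sym eq_sym (finset.setUC [set x]). Qed.

Lemma add_adj_irr u v : irreflexive (add_adj u v).
Proof. by move=> x; rewrite /add_adj /= adj_irr eqxx. Qed.

Definition add_edge u v : sgraph :=
  SGraph (add_adj_sym u v) (add_adj_irr u v).

Definition ind_adj A : rel {x : G | x \in A} :=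
  [rel x y | adj (val x) (val y)].

Lemma ind_adj_sym A : symmetric (@ind_adj A).
Proof. by move=> x y; rewrite /ind_adj /= adj_sym. Qed.

Lemma ind_adj_irr A : irreflexive (@ind_adj A).
Proof. by move=> x; rewrite /ind_adj /= adj_irr. Qed.

Definition induced A : sgraph := SGraph (@ind_adj_sym A) (@ind_adj_irr A).

End Graphs.

Record config := Config {
  cgraph :> sgraph;
  cs : cgraph;
  cu : cgraph;
  cv : cgraph }.

Section LocalDatum.

Record labelled_config := LabelledConfig {
  lconfig :> config;
  lab : lconfig -> nat }.

Definition isomorphic (C D : labelled_config) : Prop :=
  exists f : C -> D,
    [/\ bijective f,
        forall x y, adj (f x) (f y) = adj x y,
        forall x, lab (f x) = lab x
      & [/\ f (cs C) = cs D, f (cu C) = cu D & f (cv C) = cv D]].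

Variables (r : nat) (C : config).

Definition marks : {set C} := [set cs C; cu C; cv C].

Definition marks_ball : {set C} := [set x | gdist_set x marks <= r].

Lemma mark_in_ball x : x \in marks -> x \in marks_ball.
Proof.
move=> xm; rewrite inE; suff d0 : gdist x x = 0.
  have := bigmin_le_cond #|C| (gdist x) xm.
  by rewrite d0 leEnat leqn0 /gdist_set => /eqP ->.
have w0 : walk_of_length 0 x x.
  by apply/fintype.existsP; exists [tuple]; rewrite /= eqxx.
rewrite /gdist; have /prednK <- : 0 < #|C| by apply/card_gt0P; exists x.
by rewrite /= w0.
Qed.

Lemma cs_in_ball : cs C \in marks_ball.
Proof. by apply: mark_in_ball; rewrite !inE eqxx. Qed.

Lemma cu_in_ball : cu C \in marks_ball.
Proof. by apply: mark_in_ball; rewrite !inE eqxx orbT. Qed.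

Lemma cv_in_ball : cv C \in marks_ball.
Proof. by apply: mark_in_ball; rewrite !inE eqxx orbT. Qed.

(* A representative of the isomorphism class; the labels are degrees in the
   ambient graph, not in the induced subgraph. *)
Definition local_datum : labelled_config :=
  @LabelledConfig
    (@Config (induced marks_ball)
       (exist _ (cs C) cs_in_ball)
       (exist _ (cu C) cu_in_ball)
       (exist _ (cv C) cv_in_ball))
    (fun x => deg (val x)).

End LocalDatum.

Local Open Scope ring_scope.

Section RandomWalk.
Variables (R : realType) (G : sgraph).

Definition step_prob (x y : G) : R := if adj x y then (deg x)%:R^-1 else 0.

(* P_x(X_1 = p_1, ..., X_n = p_n) for simple random walk started at x *)
Fixpoint traj_prob (x : G) (p : seq G) : R :=
  if p is y :: p' then step_prob x y * traj_prob y p' else 1.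

(* all vertices have been visited at times 0, ..., m along s, w_1, w_2, ... *)
Definition covered_at (s : G) (w : seq G) (m : nat) : bool :=
  [forall x, x \in s :: take m w].

(* {tau_cov = n} depends only on the first n steps w of the walk. *)
Definition cover_time_eq (s : G) (n : nat) (w : n.-tuple G) : bool :=
  covered_at s w n && [forall m : 'I_n, ~~ covered_at s w m].

Definition cover_time_prob (s : G) (n : nat) : R :=
  \sum_(w : n.-tuple G | cover_time_eq s w) traj_prob s w.

(* The expectation of the extended-valued variable tau_cov: the second term
   is the contribution of the event {tau_cov = oo}, with +oo * 0 = 0. *)
Definition t_cov (s : G) : \bar R :=
  (\sum_(0 <= n <oo) (n%:R * cover_time_prob s n)%:E
   + +oo * (1 - \sum_(0 <= n <oo) (cover_time_prob s n)%:E))%E.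

(* f is a potential driving a unit current from u to v through unit
   resistors: Ohm's law gives the current f x - f y along xy, and Kirchhoff's
   current law holds at each vertex. *)
Definition unit_flow_potential (u v : G) (f : G -> R) : Prop :=
  forall x, \sum_(y | adj x y) (f x - f y) = (x == u)%:R - (x == v)%:R.

(* In a connected graph f is unique up to an additive constant, so exactly
   one rho qualifies. *)
Definition eff_res (u v : G) : R :=
  xget 0 (fun rho => exists2 f, unit_flow_potential u v f & rho = f u - f v).

End RandomWalk.

Definition delta (R : realType) (C : config) : \bar R :=
  (@t_cov R (add_edge (cu C) (cv C)) (cs C) - t_cov R (cs C))%E.

(* Main.v *)
(** The condition on degrees, distance and resistance forces [s], [u], [v] to be three
    leaves at a common vertex [h].  Attach at [h] a path of length [L = r] whose far
    end lies in a clique with [N] further vertices; the radius-[r] local datum does not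
    see the clique, hence does not depend on [N].  Let [Z] be the cover time of the
    clique.  Inclusion-exclusion for [max(tau_u, tau_v, Z)], together with the fact
    that [min(tau_u, tau_v)] is not affected by the edge [uv], shows that
    [delta = 2 Delta E tau_u + Delta E Z - 2 Delta E min(tau_u, Z)].
    If [N = 1] the graph is a spider with one long leg, all these hitting times are
    explicit, and the lengthening of the excursions into [{u, v}] wins: [delta > 0].
    If [N] is large, [u] and [v] are the bottleneck: [E tau_u] is two thirds of what it
    was, a gain of order [N^2], while [E Z] is of smaller order: [delta < 0].
    The expectations are bounded by sub- and supersolutions of the one-step equation
    on pairs (position, visited set). *)

Require Import Defs.
From mathcomp Require Import all_boot all_order all_algebra.
From mathcomp Require Import boolp reals ereal topology normedtype sequences.
From mathcomp Require Import ring lra zify.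

Set Implicit Arguments.
Unset Strict Implicit.
Unset Printing Implicit Defensive.

Import Order.TTheory GRing.Theory Num.Theory.

Local Open Scope ring_scope.

(** * Tail sums *)

Section TailSums.
Variables (R : realType) (p q : nat -> R).
Hypotheses (p0 : p 0 = 1 - q 0) (pS : forall n, p n.+1 = q n - q n.+1).
Hypotheses (p_ge0 : forall n, 0 <= p n) (q_ge0 : forall n, 0 <= q n).

(** With [p n] = P(tau = n) and [q n] = P(tau > n), this is the extended expectation of tau, in the
    shape of [t_cov]. *)
Let expectation : \bar R :=
  (\sum_(0 <= n <oo) (n%:R * p n)%:E
   + +oo * (1 - \sum_(0 <= n <oo) (p n)%:E))%E.

Lemma tail_nonincreasing m n : (m <= n)%N -> q n <= q m.
Proof.
move=> /subnK <-; elim: (n - m)%N => // k IH.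
by rewrite addSn (le_trans _ IH) // -subr_ge0 -pS.
Qed.

Lemma sum_point_masses k : \sum_(0 <= n < k.+1) p n = 1 - q k.
Proof.
elim: k => [|k IH]; first by rewrite big_nat1.
by rewrite big_nat_recr //= IH pS addrA subrK.
Qed.

(** Summation by parts; the boundary term is k P(tau > k). *)
Lemma sum_truncated_mean k :
  \sum_(0 <= n < k.+1) n%:R * p n = \sum_(0 <= j < k) q j - k%:R * q k.
Proof.
elim: k => [|k IH]; first by rewrite big_nat1 big_geq // !mul0r subr0.
by rewrite big_nat_recr //= IH pS big_nat_recr //= -!natr1; ring.
Qed.

Lemma mass_le1 : (\sum_(0 <= n <oo) (p n)%:E <= 1)%E.
Proof.
apply: lime_le.
  by apply: is_cvg_nneseries => n _ _; rewrite lee_fin.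
apply: nearW => -[|k]; first by rewrite big_geq // lee_fin ler01.
by rewrite sumEFin lee_fin sum_point_masses lerBlDr lerDl.
Qed.

Lemma mass_eq1 :
  (forall e, 0 < e -> exists k, q k <= e) <->
  (\sum_(0 <= n <oo) (p n)%:E = 1)%E.
Proof.
split=> [small|mass1 e e0].
  apply/eqP; rewrite eq_le mass_le1 /=; apply/lee_addgt0Pr => e e0.
  have [k qk] := small e e0.
  apply: (@le_trans _ _ (\sum_(0 <= n < k.+1) (p n)%:E + e%:E)%E).
    by rewrite sumEFin sum_point_masses -EFinD lee_fin; lra.
  by rewrite leeD2r // nneseries_lim_ge // => n _ _; rewrite lee_fin.
apply: contrapT => noq.
have : (\sum_(0 <= n <oo) (p n)%:E <= (1 - e)%:E)%E.
  apply: lime_le.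
    by apply: is_cvg_nneseries => n _ _; rewrite lee_fin.
  apply: nearW => k; rewrite sumEFin lee_fin.
  (* Adding and removing [p k] makes the formula for k + 1 terms apply, also when k = 0. *)
  have -> : \sum_(0 <= n < k) p n = \sum_(0 <= n < k.+1) p n - p k.
    by rewrite big_nat_recr //= addrK.
  rewrite sum_point_masses; have := p_ge0 k.
  have : e < q k by rewrite ltNge; apply/negP => qk; apply: noq; exists k.
  by lra.
by rewrite mass1 lee_fin; lra.
Qed.

Lemma expectation_finite :
  (forall e, 0 < e -> exists k, q k <= e) ->
  expectation = (\sum_(0 <= n <oo) (n%:R * p n)%:E)%E.
Proof.
by move=> /mass_eq1 mass1; rewrite /expectation mass1 subee // mule0 adde0.
Qed.

Lemma expectation_infinite :
  ~ (forall e, 0 < e -> exists k, q k <= e) -> expectation = +oo%E.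
Proof.
move=> /mass_eq1/eqP mass1; rewrite /expectation gt0_mulye.
  rewrite addey // gt_eqF // (@lt_le_trans _ _ 0%E) ?ltNy0 //.
  by apply: nneseries_ge0 => n _ _; rewrite lee_fin mulr_ge0.
by rewrite sube_gt0 lt_neqAle mass1 mass_le1.
Qed.

(** The bound on tail sums forces [q] to tend to 0, so tau is almost surely finite and the error
    [C * q n] disappears in the limit. *)
Lemma expectation_le (F C : R) : 0 <= C ->
  (forall n, \sum_(0 <= j < n) q j <= F + C * q n) -> (expectation <= F%:E)%E.
Proof.
move=> C0 sumq.
have small e : 0 < e -> exists k, q k <= e.
  move=> e0; set B := F + C * q 0.
  (* By monotonicity k [q k] is at most the sum of the first k tails, hence at most [B]; so k >
     [B / e] forces [q k <= e]. *)
  set k := (Num.bound `|B / e|).+1; exists k; rewrite leNgt; apply/negP => ek.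
  have : B / e < k%:R.
    apply: le_lt_trans (ler_norm _) _; apply: lt_trans (archi_boundP _) _ => //.
    by rewrite ltr_nat.
  rewrite ltr_pdivrMr // ltNge => /negP; apply.
  apply: le_trans (_ : k%:R * q k <= _); first by rewrite ler_wpM2l // ltW.
  apply: le_trans (_ : \sum_(0 <= j < k) q j <= _); last first.
    by apply: le_trans (sumq k) _; rewrite lerD2l ler_wpM2l ?tail_nonincreasing.
  rewrite mulr_natl -[X in _ *+ X]subn0 -sumr_const_nat !big_nat.
  by apply: ler_sum => j /andP[_ /ltnW]; exact: tail_nonincreasing.
rewrite expectation_finite //; apply: lime_le.
  by apply: is_cvg_nneseries => n _ _; rewrite lee_fin mulr_ge0.
apply: nearW => -[|k]; rewrite sumEFin lee_fin.
  (* The empty partial sum requires 0 <= F, which follows from the hypothesis at an index with a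
     small tail. *)
  rewrite big_geq //; apply/ler_addgt0Pr => e e0.
  have [k qk] : exists k, q k <= e / (C + 1) by apply: small; rewrite divr_gt0 //; lra.
  apply: le_trans (_ : F + C * q k <= _).
    by apply: le_trans (sumq k); rewrite sumr_ge0.
  rewrite lerD2l; apply: le_trans (_ : (C + 1) * q k <= _).
    by rewrite ler_wpM2r // lerDl.
  by rewrite mulrC -ler_pdivlMr //; lra.
apply/ler_addgt0Pr => e e0.
have [m qm] : exists k, q k <= e / (C + 1) by apply: small; rewrite divr_gt0 //; lra.
set n := maxn k m.
have qn : q n <= e / (C + 1).
  by apply: le_trans qm; rewrite tail_nonincreasing // leq_maxr.
have Cqn : C * q n <= e.
  apply: le_trans (_ : (C + 1) * q n <= _); first by rewrite ler_wpM2r // lerDl.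
  by rewrite mulrC -ler_pdivlMr //; lra.
rewrite sum_truncated_mean.
have : \sum_(0 <= j < k) q j <= \sum_(0 <= j < n) q j.
  by rewrite [leRHS](@big_cat_nat _ _ _ k) ?leq_maxl //= lerDl sumr_ge0.
have := sumq n; have : 0 <= k%:R * q k by rewrite mulr_ge0.
by lra.
Qed.

(** If [q] does not tend to 0 the expectation is infinite. Otherwise take k with [C * q k] small,
    then n >= k with k [q n] small: the mean truncated at n is at least the sum of the first k tails
    minus k [q n]. *)
Lemma expectation_ge (F C : R) : 0 <= C ->
  (forall n, F <= \sum_(0 <= j < n) q j + C * q n) -> (F%:E <= expectation)%E.
Proof.
move=> C0 sumq.
have [small|] := pselect (forall e, 0 < e -> exists k, q k <= e); last first.
  by move=> /expectation_infinite ->; rewrite leey.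
rewrite expectation_finite //; apply/lee_addgt0Pr => e e0.
have [k qk] : exists k, q k <= e / 2 / (C + 1).
  by apply: small; rewrite !divr_gt0 //; lra.
have Cqk : C * q k <= e / 2.
  apply: le_trans (_ : (C + 1) * q k <= _); first by rewrite ler_wpM2r // lerDl.
  by rewrite mulrC -ler_pdivlMr //; lra.
have [m qm] : exists m, q m <= e / 2 / (k%:R + 1).
  by apply: small; rewrite !divr_gt0 //; have := ler0n R k; lra.
set n := maxn k m.
have qn : q n <= e / 2 / (k%:R + 1).
  by apply: le_trans qm; rewrite tail_nonincreasing // leq_maxr.
have kqn : k%:R * q n <= e / 2.
  apply: le_trans (_ : (k%:R + 1) * q n <= _); first by rewrite ler_wpM2r // lerDl.
  by rewrite mulrC -ler_pdivlMr //; have := ler0n R k; lra.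
apply: (@le_trans _ _ (\sum_(0 <= i < n.+1) (i%:R * p i)%:E + e%:E)%E); last first.
  by rewrite leeD2r // nneseries_lim_ge // => i _ _; rewrite lee_fin mulr_ge0.
rewrite sumEFin -EFinD lee_fin sum_truncated_mean.
rewrite (@big_cat_nat _ _ _ k) ?leq_maxl //=.
have : n%:R * q n - k%:R * q n <= \sum_(k <= j < n) q j.
  rewrite -mulrBl -natrB ?leq_maxl // mulr_natl -sumr_const_nat !big_nat.
  by apply: ler_sum => j /andP[_ /ltnW]; exact: tail_nonincreasing.
have := sumq k; lra.
Qed.

End TailSums.

(** * Cover times and one-step inequalities *)

Lemma big_tuple_cons (R : nmodType) (T : finType) n (P : pred (seq T))
    (F : seq T -> R) :
  \sum_(w : n.+1.-tuple T | P w) F w =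
  \sum_y \sum_(w : n.-tuple T | P (y :: w)) F (y :: w).
Proof.
rewrite pair_big_dep /=.
rewrite (reindex (fun yw : T * n.-tuple T => [tuple of yw.1 :: yw.2])) //=.
exists (fun w => (thead w, [tuple of behead w])) => [[y w]|w] _ /=.
  by rewrite theadE; congr pair; apply: val_inj.
by rewrite -tuple_eta.
Qed.

Section CoverTimeBounds.
Variables (R : realType) (G : sgraph).
Implicit Types (x y s : G) (V : {set G}).

Definition covers V (w : seq G) := V :|: [set z in w] == setT.

Definition first_covers V (w : seq G) n :=
  covers V w && [forall m : 'I_n, ~~ covers V (take m w)].

Definition cover_prob n x V : R :=
  \sum_(w : n.-tuple G | first_covers V w n) traj_prob R x w.

(** P(tau_cov > n) from [x] with [V] already visited, by conditioning on the first step. The Markov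
    chain of pairs (position, visited set) underlies all later estimates. *)
Fixpoint uncovered_prob n x V : R :=
  if V == setT then 0 else
  if n is n'.+1 then
    \sum_y step_prob R x y * uncovered_prob n' y (y |: V)
  else 1.

Lemma covers_cons V y w : covers V (y :: w) = covers (y |: V) w.
Proof.
by rewrite /covers set_cons finset.setUCA finset.setUA.
Qed.

Lemma covers_nil V : covers V [::] = (V == setT).
Proof. by rewrite /covers set_nil finset.setU0. Qed.

Lemma first_covers_cons V y w n :
  first_covers V (y :: w) n.+1 = (V != setT) && first_covers (y |: V) w n.
Proof.
rewrite /first_covers covers_cons andbCA; congr andb.
apply/forallP/andP => [H|[VT /forallP H] [[|m] mn]] /=.
- split; first by have := H ord0; rewrite /= covers_nil.
  by apply/forallP => m; have := H (lift ord0 m); rewrite /= covers_cons.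
- by rewrite covers_nil.
- by rewrite covers_cons; apply: (H (Ordinal (mn : (m < n)%N))).
Qed.

Lemma cover_prob0 x V : cover_prob 0 x V = 1 - uncovered_prob 0 x V.
Proof.
rewrite /cover_prob /= big_mkcond (big_pred1 [tuple]) => [|w]; last first.
  by rewrite [w]tuple0 /= eqxx.
rewrite /first_covers covers_nil /=.
rewrite (_ : [forall _, _] = true); last by apply/forallP => -[].
by rewrite andbT; case: eqP => _; rewrite ?subr0 ?subrr.
Qed.

Lemma cover_prob_cons n x V :
  cover_prob n.+1 x V =
  if V == setT then 0 else \sum_y step_prob R x y * cover_prob n y (y |: V).
Proof.
rewrite /cover_prob.
rewrite (big_tuple_cons n (fun w => first_covers V w n.+1) (traj_prob R x)).
case: ifPn => VT.
  by apply: big1 => y _; apply: big1 => w; rewrite first_covers_cons VT.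
apply: eq_bigr => y _; rewrite mulr_sumr.
by apply: eq_bigl => w; rewrite first_covers_cons VT.
Qed.

Lemma step_prob_sum x (f : G -> R) :
  \sum_y step_prob R x y * f y = (deg x)%:R^-1 * \sum_(y | adj x y) f y.
Proof.
rewrite [X in _ * X]big_mkcond mulr_sumr; apply: eq_bigr => y _.
by rewrite /step_prob; case: ifP; rewrite ?mulr0 ?mul0r.
Qed.

Lemma step_prob_ge0 x y : 0 <= step_prob R x y.
Proof. by rewrite /step_prob; case: ifP. Qed.

Hypothesis no_isolated : forall x : G, exists y, adj x y.

Lemma deg_gt0 x : (0 : R) < (deg x)%:R.
Proof.
rewrite ltr0n; apply/card_gt0P; have [y xy] := no_isolated x.
by exists y; rewrite inE.
Qed.

Lemma step_prob1 x : \sum_y step_prob R x y = 1.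
Proof.
under eq_bigr do rewrite -[step_prob _ _ _]mulr1.
rewrite step_prob_sum sumr_const -cardsE mulVf //.
by rewrite gt_eqF // deg_gt0.
Qed.

Lemma cover_prob_ge0 n x V : 0 <= cover_prob n x V.
Proof.
elim: n x V => [|n IH] x V.
  by rewrite cover_prob0 /=; case: ifP; rewrite ?subr0 ?subrr.
rewrite cover_prob_cons; case: ifP => // _.
by apply: sumr_ge0 => y _; rewrite mulr_ge0 ?step_prob_ge0.
Qed.

Lemma uncovered_prob_ge0 n x V : 0 <= uncovered_prob n x V.
Proof.
elim: n x V => [|n IH] x V /=; case: ifP => // _.
by apply: sumr_ge0 => y _; rewrite mulr_ge0 ?step_prob_ge0.
Qed.

Lemma cover_probS n x V :
  cover_prob n.+1 x V = uncovered_prob n x V - uncovered_prob n.+1 x V.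
Proof.
elim: n x V => [|n IH] x V; rewrite cover_prob_cons /=.
  case: ifP => _; first by rewrite subrr.
  rewrite -[X in X - _](step_prob1 x) -sumrB; apply: eq_bigr => y _.
  by rewrite cover_prob0 mulrBr mulr1.
case: ifP => _; first by rewrite subrr.
by rewrite -sumrB; apply: eq_bigr => y _; rewrite IH mulrBr.
Qed.

Lemma cover_time_probE s n : cover_time_prob R s n = cover_prob n s [set s].
Proof.
apply: eq_bigl => w.
have E m : covered_at s w m = covers [set s] (take m w).
  rewrite /covered_at /covers; apply/forallP/eqP => [H|H x].
    by apply/setP => x; rewrite !inE -in_cons H.
  by have := in_setT x; rewrite -H !inE.
rewrite /cover_time_eq /first_covers E take_oversize ?size_tuple //.
by congr andb; apply: eq_forallb => m; rewrite E.
Qed.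

Section Potential.
(** [I] is an invariant of the chain: the one-step inequality for the potential [F] is only required
    on pairs satisfying it. *)
Variables (I : G -> {set G} -> Prop) (F : G -> {set G} -> R).
Hypothesis I_step : forall x y V, I x V -> adj x y -> I y (y |: V).

Let F_bound := \sum_x \sum_V `|F x V|.

Let F_boundP x V : - F_bound <= F x V <= F_bound.
Proof.
rewrite -ler_norml /F_bound (bigD1 x) //= (bigD1 V) //=.
rewrite -!addrA lerDl addr_ge0 //; apply: sumr_ge0 => // y _.
exact: sumr_ge0.
Qed.

(* The sign of [e] makes this an upper bound for [F' = F] or a lower one for [F' = - F]. *)
Lemma uncovered_sum_le (e : R) (F' : G -> {set G} -> R) (C : R) :
  (forall x V, - C <= F' x V) ->
  (forall x, I x setT -> 0 <= F' x setT) ->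
  (forall x V, I x V -> V != setT ->
     0 <= \sum_(y | adj x y) (F' x V - F' y (y |: V) - e)) ->
  forall n x V, I x V ->
    \sum_(0 <= k < n) e * uncovered_prob k x V
      <= F' x V + C * uncovered_prob n x V.
Proof.
move=> F'C F'T F'step; elim=> [|n IH] x V IxV; case: (eqVneq V setT) => VT.
- by rewrite big_geq // /= VT eqxx mulr0 addr0 F'T // -VT.
- by rewrite big_geq // /= (negPf VT) mulr1 addrC -lerBlDl sub0r.
- rewrite big1 => [|k _]; last by case: k => [|k] /=; rewrite VT eqxx mulr0.
  by rewrite /= VT eqxx mulr0 addr0 F'T // -VT.
rewrite big_nat_recl //= (negPf VT) mulr1.
under eq_bigr do rewrite mulr_sumr.
rewrite exchange_big /= mulr_sumr.
have sumF : \sum_(i : G) \sum_(0 <= k < n)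
      e * (step_prob R x i * uncovered_prob k i (i |: V)) <=
    \sum_i step_prob R x i * F' i (i |: V)
    + \sum_i C * (step_prob R x i * uncovered_prob n i (i |: V)).
  rewrite -big_split /=; apply: ler_sum => y _.
  rewrite [in leRHS]mulrCA -mulrDr.
  under eq_bigr do rewrite mulrCA.
  rewrite -mulr_sumr /step_prob; case: ifP => [xy|]; last by rewrite !mul0r.
  by rewrite ler_wpM2l // IH //; apply: I_step xy.
(* The induction has reduced the claim to a supersolution inequality for the average over one step;
   [F'step] is that inequality multiplied by the degree of [x]. *)
suff : e + \sum_i step_prob R x i * F' i (i |: V) <= F' x V by lra.
have := F'step x V IxV VT; rewrite step_prob_sum !sumrB.
rewrite !sumr_const -cardsE -/(deg x) => H.
rewrite -(ler_pM2l (deg_gt0 x)) mulrDr mulrA mulfV ?mul1r; last first.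
  by rewrite gt_eqF // deg_gt0.
by rewrite -(mulr_natl (F' x V)) -(mulr_natl e) in H; lra.
Qed.

Variable s : G.
Hypothesis I_start : I s [set s].

(** A supersolution that is nonnegative once everything is visited dominates the expected cover
    time; finiteness of the state space supplies the bound on the error at time n. *)
Lemma t_cov_le :
  (forall x, I x setT -> 0 <= F x setT) ->
  (forall x V, I x V -> V != setT ->
     0 <= \sum_(y | adj x y) (F x V - F y (y |: V) - 1)) ->
  (t_cov R s <= (F s [set s])%:E)%E.
Proof.
move=> FT Fstep.
apply: (@expectation_le R (cover_time_prob R s)
          (fun n => uncovered_prob n s [set s]) _ _ _ _ _ F_bound).
- by rewrite cover_time_probE cover_prob0.
- by move=> n; rewrite cover_time_probE cover_probS.
- by move=> n; rewrite cover_time_probE cover_prob_ge0.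
- by move=> n; apply: uncovered_prob_ge0.
- by apply: sumr_ge0 => x _; apply: sumr_ge0.
move=> n; rewrite -[leLHS]mul1r mulr_sumr.
by apply: uncovered_sum_le => // x V; have /andP[] := F_boundP x V.
Qed.

Lemma t_cov_ge :
  (forall x, I x setT -> F x setT <= 0) ->
  (forall x V, I x V -> V != setT ->
     \sum_(y | adj x y) (F x V - F y (y |: V) - 1) <= 0) ->
  ((F s [set s])%:E <= t_cov R s)%E.
Proof.
move=> FT Fstep.
apply: (@expectation_ge R (cover_time_prob R s)
          (fun n => uncovered_prob n s [set s]) _ _ _ _ _ F_bound).
- by rewrite cover_time_probE cover_prob0.
- by move=> n; rewrite cover_time_probE cover_probS.
- by move=> n; rewrite cover_time_probE cover_prob_ge0.
- by move=> n; apply: uncovered_prob_ge0.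
- by apply: sumr_ge0 => x _; apply: sumr_ge0.
move=> n.
(* A subsolution is treated as a supersolution by changing the sign of [F] and of the running
   cost. *)
have := @uncovered_sum_le (- 1) (fun x V => - F x V) F_bound.
move=> /(_ _ _ _ n s [set s] I_start); rewrite -mulr_sumr mulN1r => H.
suff: - (\sum_(0 <= i < n) uncovered_prob i s [set s]) <=
  - F s [set s] + F_bound * uncovered_prob n s [set s] by lra.
apply: H => [x V|x IT|x V IxV VT].
- by have := F_boundP x V; lra.
- by have := FT x IT; lra.
rewrite -oppr_le0 -sumrN; apply: le_trans (Fstep x V IxV VT).
by apply: ler_sum => y _; lra.
Qed.

End Potential.
End CoverTimeBounds.

(** * The lollipop with three leaves *)

Section Distance.
Variable G : sgraph.
Implicit Types (x y : G) (A : {set G}).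

Lemma gdist_le n x y : walk_of_length n x y -> (n < #|G|)%N -> (gdist x y <= n)%N.
Proof.
move=> w nG; rewrite leqNgt; apply/negP => /(before_find 0).
by rewrite nth_iota // add0n w.
Qed.

Lemma gdist_walk x y : (gdist x y < #|G|)%N -> walk_of_length (gdist x y) x y.
Proof.
move=> dG; have := dG; rewrite -[X in (_ < X)%N](size_iota 0) -has_find => /(nth_find 0).
by rewrite nth_iota // add0n.
Qed.

Lemma gdist_setP x A n : (n < #|G|)%N ->
  reflect (exists2 a, a \in A & (gdist x a <= n)%N) (gdist_set x A <= n)%N.
Proof.
move=> nG; apply: (iffP idP) => [|[a aA xa]]; last first.
  by apply: leq_trans xa; rewrite -leEnat; apply: bigmin_le_cond.
rewrite /gdist_set; elim/big_ind: _ => [|a b IHa IHb|a aA da]; last by exists a.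
  by rewrite leqNgt nG.
by rewrite /Order.min; case: ifP.
Qed.

End Distance.

Section Lollipop.
Variables L N : nat.

(* [leaf] are the three leaves at the hub [stem 0]; the stem is the path
   [stem 0], ..., [stem L], and [stem L] together with the [cliq k] is a clique.
   [stem p] is a junk value when [p > L].  The flag [b] of [ladj] adds the edge
   between the last two leaves. *)
Definition lvtx : finType := (('I_3 + 'I_L.+1) + 'I_N)%type.

Definition leaf (i : 'I_3) : lvtx := inl (inl i).
Definition stem (p : nat) : lvtx := inl (inr (inord p)).
Definition cliq (k : 'I_N) : lvtx := inr k.

Definition ls := leaf (@Ordinal 3 0 isT).
Definition lu := leaf (@Ordinal 3 1 isT).
Definition lv := leaf (@Ordinal 3 2 isT).

Definition ladj (b : bool) : rel lvtx := fun x y =>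
  match x, y with
  | inl (inl i), inl (inl j) => [&& b, (0 < i)%N, (0 < j)%N & i != j]
  | inl (inl _), inl (inr q) => q == 0 :> nat
  | inl (inr p), inl (inl _) => p == 0 :> nat
  | inl (inr p), inl (inr q) => (p.+1 == q) || (q.+1 == p)
  | inl (inr p), inr _ => p == L :> nat
  | inr _, inl (inr q) => q == L :> nat
  | inr k, inr l => k != l
  | _, _ => false
  end.

Lemma ladj_sym b : symmetric (ladj b).
Proof.
move=> [[i|p]|k] [[j|q]|l]; try exact: erefl.
- by rewrite /= [i == j]eq_sym; congr andb; rewrite andbCA.
- by rewrite /= orbC.
by rewrite /= eq_sym.
Qed.

Lemma ladj_irr b : irreflexive (ladj b).
Proof.
by move=> [[i|p]|k] /=; rewrite ?eqxx ?andbF // orbb; lia.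
Qed.

Definition lgraph b : sgraph := SGraph (ladj_sym b) (ladj_irr b).

Lemma lvtx_ind (P : lvtx -> Prop) :
  P ls -> P lu -> P lv -> P (stem 0) ->
  (forall p, (0 < p < L)%N -> P (stem p)) -> P (stem L) ->
  (forall k, P (cliq k)) -> forall x, P x.
Proof.
move=> Ps Pu Pv P0 Pp PL Pk [[i|p]|k]; last exact: Pk.
  by case: i => -[|[|[|//]]] i3; rewrite (bool_irrelevance i3 isT).
have -> : inl (inr p) = stem p by rewrite /stem inord_val.
have [->|p0] := posnP p; first by [].
have [->|pL] := eqVneq (p : nat) L; first by [].
by apply: Pp; rewrite p0 ltn_neqAle pL -ltnS ltn_ord.
Qed.

(** * Neighbourhoods in the lollipop *)

Section NeighbourSums.
Variables (R : nmodType) (b : bool) (f : lvtx -> R).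
Hypothesis L_gt0 : (0 < L)%N.

Let big_lvtx (P : pred lvtx) :
  \sum_(y | P y) f y =
  \sum_(i < 3 | P (leaf i)) f (leaf i)
  + \sum_(p < L.+1 | P (inl (inr p))) f (inl (inr p))
  + \sum_(k < N | P (cliq k)) f (cliq k).
Proof. by rewrite !big_sumType. Qed.

Let big_leaf (P : pred 'I_3) :
  \sum_(i < 3 | P i) f (leaf i) =
  (f ls *+ P (@Ordinal 3 0 isT)) + (f lu *+ P (@Ordinal 3 1 isT))
  + (f lv *+ P (@Ordinal 3 2 isT)).
Proof.
rewrite big_mkcond !big_ord_recl big_ord0 /= addr0 addrA -!mulrb.
have E (i j : 'I_3) : val i = val j -> f (leaf i) *+ P i = f (leaf j) *+ P j.
  by move=> /val_inj ->.
by congr (_ + _ + _); apply: E.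
Qed.

Let big_stem1 (P : pred 'I_L.+1) q : (q <= L)%N ->
  (forall p : 'I_L.+1, P p = (p == q :> nat)) ->
  \sum_(p < L.+1 | P p) f (inl (inr p)) = f (stem q).
Proof.
move=> qL Pq; rewrite (big_pred1 (inord q)) // => p.
by rewrite Pq -[RHS](inj_eq val_inj) /= inordK.
Qed.

Let big0 (I : finType) (P : pred I) (g : I -> R) :
  (forall i, P i = false) -> \sum_(i | P i) g i = 0.
Proof. by move=> P0; rewrite big_pred0. Qed.

(** The [nbsum] lemmas list the neighbours of each kind of vertex as an identity in an arbitrary
    [f]: [f] = 1 yields degrees, other choices yield drifts and Kirchhoff's law. *)
Lemma nbsum_ls : \sum_(y | ladj b ls y) f y = f (stem 0).
Proof.
by rewrite big_lvtx big_leaf /= !andbF /= (big_stem1 (leq0n _)) // big0 //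
  !mulr0n !add0r addr0.
Qed.

Lemma nbsum_lu : \sum_(y | ladj b lu y) f y = f (stem 0) + f lv *+ b.
Proof.
by rewrite big_lvtx big_leaf /= !andbF /= !andbT (big_stem1 (leq0n _)) // big0 //
  !mulr0n !add0r addr0 addrC.
Qed.

Lemma nbsum_lv : \sum_(y | ladj b lv y) f y = f (stem 0) + f lu *+ b.
Proof.
by rewrite big_lvtx big_leaf /= !andbF /= !andbT (big_stem1 (leq0n _)) // big0 //
  !mulr0n !add0r !addr0 addrC.
Qed.

Lemma nbsum_stem0 :
  \sum_(y | ladj b (stem 0) y) f y = f ls + f lu + f lv + f (stem 1).
Proof.
rewrite big_lvtx big_leaf /stem /= inordK //= (big_stem1 L_gt0) ?big0 ?addr0 //.
  by move=> k; lia.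
by move=> p; lia.
Qed.

Lemma nbsum_stem p : (0 < p < L)%N ->
  \sum_(y | ladj b (stem p) y) f y = f (stem p.-1) + f (stem p.+1).
Proof.
move=> pL; rewrite big_lvtx big_leaf /stem /= inordK; last by lia.
have -> : (p == 0%N) = false by lia.
rewrite !mulr0n !add0r [X in _ + X]big0 ?addr0; last by move=> k /=; lia.
rewrite (bigD1 (inord p.-1)) /=; last by rewrite inordK; lia.
rewrite (@big_stem1 _ p.+1) //; first by lia.
by move=> q; rewrite -[q == _](inj_eq val_inj) /= inordK; lia.
Qed.

Lemma nbsum_stemL :
  \sum_(y | ladj b (stem L) y) f y = f (stem L.-1) + \sum_k f (cliq k).
Proof.
rewrite big_lvtx big_leaf /stem /= inordK; last by lia.
have -> : (L == 0%N) = false by lia.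
rewrite !mulr0n !add0r; congr (_ + _); last by apply: eq_bigl => k /=; rewrite eqxx.
by apply: big_stem1 => [|q]; [lia | have := ltn_ord q; lia].
Qed.

Lemma nbsum_cliq k :
  \sum_(y | ladj b (cliq k) y) f y = f (stem L) + \sum_(l | l != k) f (cliq l).
Proof.
rewrite big_lvtx big_leaf /= !mulr0n !add0r (@big_stem1 _ L) //.
by congr (_ + _); apply: eq_bigl => l; rewrite eq_sym.
Qed.

End NeighbourSums.

(** Distance to the nearest leaf; the marks are exactly the leaves. *)
Definition level (x : lvtx) : nat :=
  match x with inl (inl _) => 0 | inl (inr p) => p.+1 | inr _ => L.+2 end.

Lemma level_adj b x y : ladj b x y -> (level y <= (level x).+1)%N.
Proof. by move: x y => [[i|p]|k] [[j|q]|l] //=; rewrite ?ltnS; lia. Qed.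

Lemma level_path b x w :
  path (ladj b) x w -> (level x <= level (last x w) + size w)%N.
Proof.
elim: w x => [|y w IH] x /=; first by rewrite addn0.
rewrite ladj_sym addnS => /andP[/level_adj xy /IH IHw].
by apply: leq_trans xy _; rewrite ltnS.
Qed.

Lemma card_lvtx : #|lvtx| = (L + N + 4)%N.
Proof. by rewrite !card_sum !card_ord; lia. Qed.

Lemma walk_stem_leaf b p i : (p <= L)%N ->
  @walk_of_length (lgraph b) p.+1 (stem p) (leaf i).
Proof.
elim: p => [|p IH] pL; apply/existsP.
  by exists [tuple leaf i]; rewrite /= inordK //= eqxx.
have /existsP[w /andP[pw lw]] := IH (ltnW pL).
exists (cons_tuple (stem p) w).
by rewrite /= pw lw !inordK ?eqxx ?orbT // ltnW.
Qed.

Lemma lgraph_connected b : graph_connected (lgraph b).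
Proof.
have sym := sym_connect_sym (ladj_sym b).
suff conn0 x : connect (ladj b) (stem 0) x.
  by move=> x y; apply: connect_trans (conn0 y); rewrite sym.
have conn_stem p : (p <= L)%N -> connect (ladj b) (stem 0) (stem p).
  elim: p => [|p IH] pL; first exact: connect0.
  apply: connect_trans (IH (ltnW pL)) (connect1 _).
  by rewrite /= !inordK ?eqxx // ltnW.
move: x; apply: lvtx_ind => [|||||| k].
- by apply: connect1; rewrite /= inordK.
- by apply: connect1; rewrite /= inordK.
- by apply: connect1; rewrite /= inordK.
- exact: connect0.
- by move=> p /andP[_ /ltnW]; apply: conn_stem.
- exact: conn_stem.
by apply: connect_trans (conn_stem L _) (connect1 _); rewrite //= inordK.
Qed.

Definition lconf : config := @Config (lgraph false) ls lu lv.

Lemma lu_lv_nonedge : nonedge (cu lconf) (cv lconf).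
Proof. by []. Qed.

Lemma gdist_set_ls : gdist_set (cs lconf) [set cu lconf; cv lconf] = 2%N.
Proof.
have nG : (2 < #|lgraph false|)%N by rewrite card_lvtx; lia.
have gd a : a \in [set lu; lv] -> @gdist (lgraph false) ls a = 2%N.
  move=> a_uv; have le2 : (@gdist (lgraph false) ls a <= 2)%N.
    apply: gdist_le => //; apply/existsP; exists [tuple stem 0; a] => /=.
    by move: a_uv; rewrite !inE => /orP[] /eqP->; rewrite /= inordK ?eqxx.
  have : @walk_of_length (lgraph false) (gdist (ls : lgraph false) a) ls a.
    by apply: gdist_walk; apply: leq_ltn_trans nG.
  move: le2; case: gdist => [|[|[|n]]] // _ /existsP[w].
    by rewrite [w]tuple0 /=; move: a_uv; rewrite !inE => /orP[] /eqP->.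
  case/tupleP: w => y w; rewrite [w]tuple0 /= andbT => /andP[+ /eqP ya].
  by rewrite ya; move: a_uv; rewrite !inE => /orP[] /eqP->.
apply/eqP; rewrite eqn_leq; apply/andP; split.
  by apply/gdist_setP => //; exists lu; rewrite ?gd ?inE ?eqxx.
rewrite ltnNge; apply/gdist_setP; first by rewrite ltnW.
by case=> a /gd ->.
Qed.

(** A step changes the level by at most one, so the level bounds the distance from below, and
    descending the stem attains it. For [r <= L] the ball stops before [stem L], the first stem
    vertex whose degree depends on [N]. *)
Lemma in_marks_ball r x : (r <= L)%N ->
  (x \in marks_ball r lconf) = (level x <= r)%N.
Proof.
move=> rL; have nG n : (n <= L)%N -> (n < #|lgraph false|)%N.
  by rewrite card_lvtx; lia.
rewrite inE; apply/gdist_setP/idP => [|[a a_mark xa]|x_lev]; first exact: nG.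
  have /existsP[w /andP[/level_path + /eqP wa]] :
      @walk_of_length (lgraph false) (gdist (x : lgraph false) a) x a.
    by apply: gdist_walk; apply: leq_ltn_trans xa (nG _ _).
  rewrite wa size_tuple.
  suff -> : level a = 0%N by move=> /leq_trans; apply.
  by move: a_mark; rewrite !inE => /orP[/orP[]|] /eqP->.
case: x x_lev => [[i|p]|k] /= x_lev; last by lia.
  exists (leaf i).
    have : (leaf i == ls) || (leaf i == lu) || (leaf i == lv).
      by case: i => -[|[|[|//]]] i3; rewrite (bool_irrelevance i3 isT) ?eqxx ?orbT.
    by rewrite !inE.
  apply: (@leq_trans 0) => //; apply: gdist_le; last exact: nG.
  by apply/existsP; exists [tuple]; rewrite /= eqxx.
exists ls; first by rewrite !inE eqxx.
apply: leq_trans (x_lev); apply: gdist_le; last exact: nG (leq_trans x_lev rL).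
have := @walk_stem_leaf false p (@Ordinal 3 0 isT); rewrite /stem inord_val.
by apply; rewrite -ltnS.
Qed.

(** * Degrees and effective resistance *)

Section Degrees.
Hypothesis L_gt0 : (0 < L)%N.

Let degE b (x : lgraph b) : (deg x)%:R = \sum_(y | ladj b x y) 1 :> int.
Proof. by rewrite sumr_const -cardsE. Qed.

Lemma deg_ls b : deg (ls : lgraph b) = 1%N.
Proof. by apply/eqP; rewrite -(eqr_nat int) degE nbsum_ls. Qed.

Lemma deg_lu : deg (lu : lgraph false) = 1%N.
Proof. by apply/eqP; rewrite -(eqr_nat int) degE nbsum_lu. Qed.

Lemma deg_lv : deg (lv : lgraph false) = 1%N.
Proof. by apply/eqP; rewrite -(eqr_nat int) degE nbsum_lv. Qed.

Lemma deg_stem0 : deg (stem 0 : lgraph false) = 4%N.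
Proof. by apply/eqP; rewrite -(eqr_nat int) degE nbsum_stem0. Qed.

Lemma deg_stem p : (0 < p < L)%N -> deg (stem p : lgraph false) = 2%N.
Proof. by move=> pL; apply/eqP; rewrite -(eqr_nat int) degE nbsum_stem. Qed.

Lemma no_isolated b (x : lgraph b) : exists y, adj x y.
Proof.
move: x; apply: lvtx_ind => [|||||| k].
- by exists (stem 0); rewrite /= inordK.
- by exists (stem 0); rewrite /= inordK.
- by exists (stem 0); rewrite /= inordK.
- by exists ls; rewrite /= inordK.
- by move=> p pL; exists (stem p.-1); rewrite /= !inordK; lia.
- by exists (stem L.-1); rewrite /= !inordK; lia.
by exists (stem L); rewrite /= inordK.
Qed.

Lemma eff_res_lconf (R : realType) : eff_res R (cu lconf) (cv lconf) = 2.
Proof.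
apply: classical_sets.xget_unique => [|rho [f fpot ->]] /=.
  (* The unit current flows through two edges in series, and the potential is 0 everywhere else. *)
  exists (fun x => (x == lu)%:R - (x == lv)%:R); last by rewrite /=; lra.
  apply: lvtx_ind => [||||p pL||k].
  - by rewrite nbsum_ls //=; lra.
  - by rewrite nbsum_lu //=; lra.
  - by rewrite nbsum_lv //=; lra.
  - by rewrite nbsum_stem0 //=; lra.
  - by rewrite nbsum_stem //=; lra.
  - by rewrite nbsum_stemL //= big1 => [|k _] /=; lra.
  by rewrite nbsum_cliq //= big1 => [|l _] /=; lra.
(* Uniqueness of the value: Kirchhoff's law at the two leaves fixes both potentials relative to the
   hub. *)
have := fpot lu; rewrite nbsum_lu // mulr0n.
have := fpot lv; rewrite nbsum_lv // mulr0n.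
rewrite !eqxx (_ : (lu == lv) = false) // (_ : (lv == lu) = false) //.
by rewrite /=; lra.
Qed.

End Degrees.
End Lollipop.

(** * Independence of the local datum from the clique size *)

Section LocalIsomorphism.
Variables L r : nat.
Hypotheses (L_gt0 : (0 < L)%N) (rL : (r <= L)%N).

(** The identity on leaves and stem; the value on clique vertices is a default, as the ball contains
    none. *)
Let transfer N N' (x : lvtx L N) : lvtx L N' :=
  match x with inl y => inl y | inr _ => ls L N' end.

Let transfer_ball N N' (x : lvtx L N) :
  x \in marks_ball r (lconf L N) -> transfer N' x \in marks_ball r (lconf L N').
Proof. by rewrite !in_marks_ball //; case: x => [[i|p]|k]. Qed.

Let ball_inl N (x : {x | x \in marks_ball r (lconf L N)}) :
  exists2 y, val x = inl y & (level (val x) <= r)%N.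
Proof.
case: x => /= x; rewrite in_marks_ball //; case: x => [y|k /=]; first by exists y.
lia.
Qed.

Let move_ball N N' (x : {x | x \in marks_ball r (lconf L N)}) :
  {x | x \in marks_ball r (lconf L N')} :=
  exist _ (transfer N' (val x)) (transfer_ball N' (valP x)).

Let move_ballK N N' : cancel (@move_ball N N') (@move_ball N' N).
Proof.
by move=> x; have [y xE _] := ball_inl x; apply: val_inj; rewrite /= xE.
Qed.

Let deg_small N (x : lvtx L N) : (level x <= L)%N ->
  deg (x : lgraph L N false) =
  match x with inl (inl _) => 1%N | inl (inr p) => if p == 0 :> nat then 4%N else 2%N
  | _ => 0%N end.
Proof.
move: x; apply: lvtx_ind => [||||p pL||k] /=.
- by rewrite deg_ls.
- by rewrite deg_lu.
- by rewrite deg_lv.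
- by rewrite deg_stem0 // inordK.
- by rewrite deg_stem // inordK; [case: eqP pL => // -> | lia].
- by rewrite inordK // ltnn.
by rewrite ltnNge leqnSn.
Qed.

Lemma local_datum_lconf N N' :
  isomorphic (local_datum r (lconf L N)) (local_datum r (lconf L N')).
Proof.
exists (@move_ball N N'); split.
- exact: (Bijective (@move_ballK N N') (@move_ballK N' N)).
- move=> x y; have [x' xE _] := ball_inl x; have [y' yE _] := ball_inl y.
  rewrite /= /ind_adj /=; rewrite /= in xE yE; rewrite xE yE.
  by case: x' {xE} => ?; case: y' {yE}.
- move=> x; have [x' xE xr] := ball_inl x.
  rewrite /= in xE xr *; rewrite xE in xr *.
  have x'L : (level (inl x' : lvtx L N) <= L)%N by apply: leq_trans rL.
  by rewrite !deg_small.
by split; apply: val_inj.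
Qed.

End LocalIsomorphism.

(** * Inclusion-exclusion for hitting times *)

Section InclusionExclusion.
Variables (R : realType) (G : sgraph) (u v e : G).
Implicit Types (x y : G) (V : {set G}) (g : G -> R).

(** The one-step equation g = 1 + Pg multiplied by the degree, which avoids division. *)
Definition drift g x : R := \sum_(y | adj x y) (g x - g y - 1).

Definition target (a1 a2 a3 : bool) : pred G :=
  fun x => [|| a1 && (x == u), a2 && (x == v) | a3 && (x == e)].

(* The equations characterizing [x |-> E_x tau_A]. *)
Definition hitting_time (A : pred G) g : Prop :=
  (forall x, A x -> g x = 0) /\ (forall x, ~~ A x -> drift g x = 0).

Variable f : bool -> bool -> bool -> G -> R.

Definition missing V x : R := (x \notin V)%:R.

(** The expectation of max(tau_u, tau_v) = tau_u + tau_v - min(tau_u, tau_v), where the factors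
    [missing] switch off targets already visited. *)
Definition both_cover x V : R :=
  missing V u * f true false false x + missing V v * f false true false x
  - missing V u * missing V v * f true true false x.

(* The terms that a third target [e] adds to [both_cover]. *)
Definition extra_cover x V : R :=
  missing V e * f false false true x
  - missing V e * missing V u * f true false true x
  - missing V e * missing V v * f false true true x
  + missing V e * missing V u * missing V v * f true true true x.

(** Arrival at the target may be ignored in the visited set: [g] vanishes there, and any other
    arrival leaves the factor unchanged. *)
Lemma missing_setU1 g V x y : g x = 0 -> missing (y |: V) x * g y = missing V x * g y.
Proof.
rewrite /missing !inE negb_or; have [->|] := eqVneq x y => // ->.
by rewrite !mulr0.
Qed.

(** A missing target differs from the current position, so a drift that vanishes off the target
    contributes nothing. *)
Lemma missing_mul0 V x (z : G) (c : R) : x \in V ->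
  (x != z -> c = 0) -> missing V z * c = 0.
Proof.
rewrite /missing; case: (boolP (z \in V)) => zV xV; first by rewrite mul0r.
by move=> ->; rewrite ?mulr0 //; apply: contraNneq zV => <-.
Qed.

Lemma both_cover_drift x V :
  (forall a1 a2, a1 || a2 -> hitting_time (target a1 a2 false) (f a1 a2 false)) ->
  x \in V ->
  \sum_(y | adj x y) (both_cover x V - both_cover y (y |: V)
    - (~~ ((u \in V) && (v \in V)))%:R) = 0.
Proof.
move=> hf xV.
have [u0 ux] := hf true false isT; have [v0 vx] := hf false true isT.
have [uv0 uvx] := hf true true isT.
rewrite /target /= in u0 ux v0 vx uv0 uvx.
(* By linearity the sum is a combination of drifts of hitting times. With m_z for [missing V z], the
   constants add up to m_u + m_v - m_u m_v, the indicator that [u] or [v] is missing. *)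
transitivity (missing V u * drift (f true false false) x
  + missing V v * drift (f false true false) x
  - missing V u * (missing V v * drift (f true true false) x)).
  rewrite /drift !mulr_sumr -sumrN -!big_split /=; apply: eq_bigr => y _.
  rewrite /both_cover -!mulrA.
  rewrite (@missing_setU1 (f true false false)); last by rewrite u0 ?eqxx.
  rewrite (@missing_setU1 (f false true false)); last by rewrite v0 ?eqxx ?orbT.
  rewrite (@missing_setU1 (f true true false)); last by rewrite uv0 ?eqxx ?orbT.
  rewrite [missing (y |: V) u * (_ * _)]mulrCA.
  rewrite (@missing_setU1 (f true true false)); last by rewrite uv0 ?eqxx ?orbT.
  rewrite /missing; case: (u \in V); case: (v \in V) => /=; ring.
have mul0 := @missing_mul0 V x _ _ xV.
rewrite [X in X + _ - _]mul0 => [|xu]; last by rewrite ux // !orbF.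
rewrite [X in _ + X - _]mul0 => [|xv]; last by rewrite vx // orbF.
rewrite mul0 ?addr0 ?subr0 // => xu; rewrite mul0 // => xv.
by rewrite uvx // orbF negb_or xu xv.
Qed.

Lemma extra_cover_drift x V :
  (forall a1 a2, hitting_time (target a1 a2 true) (f a1 a2 true)) ->
  x \in V ->
  \sum_(y | adj x y) (extra_cover x V - extra_cover y (y |: V)
    - [&& u \in V, v \in V & e \notin V]%:R) = 0.
Proof.
move=> hf xV.
have [e0 ex] := hf false false.
have [u0 ux] := hf true false; have [v0 vx] := hf false true.
have [uv0 uvx] := hf true true.
rewrite /target /= in e0 ex u0 ux v0 vx uv0 uvx.
(* Here the constants add up to m_e (1 - m_u) (1 - m_v). *)
transitivity (missing V e * drift (f false false true) x
  - missing V e * (missing V u * drift (f true false true) x)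
  - missing V e * (missing V v * drift (f false true true) x)
  + missing V e * (missing V u * missing V v * drift (f true true true) x)).
  rewrite /drift !mulr_sumr -!sumrN -!big_split /=; apply: eq_bigr => y _.
  rewrite /extra_cover -!mulrA.
  rewrite (@missing_setU1 (f false false true)); last by rewrite e0 ?eqxx.
  rewrite (@missing_setU1 (f true false true)); last by rewrite u0 ?eqxx.
  rewrite (@missing_setU1 (f false true true)); last by rewrite v0 ?eqxx.
  rewrite (@missing_setU1 (f true true true)); last by rewrite uv0 ?eqxx ?orbT.
  rewrite ![missing (y |: V) e * (_ * _)]mulrCA.
  rewrite (@missing_setU1 (f true false true)); last by rewrite u0 ?eqxx ?orbT.
  rewrite (@missing_setU1 (f false true true)); last by rewrite v0 ?eqxx ?orbT.
  rewrite (@missing_setU1 (f true true true)); last by rewrite uv0 ?eqxx ?orbT.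
  rewrite ![missing (y |: V) u * (_ * _)]mulrCA.
  rewrite (@missing_setU1 (f true true true)); last by rewrite uv0 ?eqxx ?orbT.
  rewrite /missing; case: (u \in V); case: (v \in V); case: (e \in V) => /=; ring.
have mul0 := @missing_mul0 V x _ _ xV.
rewrite [X in X - _ - _ + _]mul0 => [|xe]; last by rewrite ex.
rewrite [X in _ - X - _ + _]mul0 => [|xe]; last first.
  by rewrite mul0 // => xu; rewrite ux // negb_or xu xe.
rewrite [X in _ - _ - X + _]mul0 => [|xe]; last first.
  by rewrite mul0 // => xv; rewrite vx // negb_or xv xe.
rewrite mul0 ?addr0 ?subr0 // => xe; rewrite -mulrA mul0 // => xu.
by rewrite mul0 // => xv; rewrite uvx // !negb_or xu xv xe.
Qed.

End InclusionExclusion.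

(** * Explicit hitting times *)

Section HittingTimes.
Variables (R : realType) (L N : nat).
Hypothesis L_gt0 : (0 < L)%N.
Implicit Types (b : bool) (k : 'I_N).

Definition vfun (s u v : R) (t : nat -> R) (h : 'I_N -> R) (x : lvtx L N) : R :=
  match x with
  | inl (inl i) => [:: s; u; v]`_i
  | inl (inr p) => t p
  | inr k => h k
  end.

Lemma vfun_stem s u v t h p : (p <= L)%N -> vfun s u v t h (stem L N p) = t p.
Proof. by move=> pL; rewrite /= inordK. Qed.

(** Time from a leaf when the hub has value [X]. With the edge, the next step goes to the hub or to
    the other leaf with probability 1/2 each; if neither is a target, T = 1 + X / 2 + T / 2 gives
    [X + 2]. *)
Definition leaf_time b (hit other_hit : bool) (X : R) : R :=
  if hit then 0
  else if b then (if other_hit then 1 + X / 2 else X + 2) else X + 1.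

(** By symmetry of the clique the system reduces to equations on the stem and at the hub. A clique
    vertex is a target only for [N] = 1, where it is the tip of a path. *)
Lemma hitting_vfun b a1 a2 a3 k0 (X : R) t (h : R) :
  t 0%N = X ->
  (forall p, (0 < p < L)%N -> t p + t p = t p.-1 + t p.+1 + 2) ->
  t L - t L.-1 - 1 + N%:R * (t L - h - 1) = 0 ->
  (if a3 then N = 1%N /\ h = 0 else h = t L + N%:R) ->
  X *+ 3 = leaf_time b a1 a2 X + leaf_time b a2 a1 X + t 1%N + 5 ->
  hitting_time (G := lgraph L N b)
    (target (G := lgraph L N b) (lu L N) (lv L N) (cliq L k0) a1 a2 a3)
    (vfun (X + 1) (leaf_time b a1 a2 X) (leaf_time b a2 a1 X) t (fun=> h)).
Proof.
move=> t0 tp tL hE hub; split.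
  move=> x /or3P[] /andP[a /eqP->]; rewrite /= /leaf_time ?a //.
  by rewrite a in hE; case: hE.
rewrite /drift; apply: lvtx_ind => [||||p pL||k] xA.
- rewrite nbsum_ls vfun_stem //= t0; lra.
- rewrite nbsum_lu vfun_stem //= t0 /leaf_time.
  case: a1 a2 b xA {hub} => -[] [] //= _; rewrite ?mulr0n ?mulr1n; lra.
- rewrite nbsum_lv vfun_stem //= t0 /leaf_time.
  by case: a1 a2 b xA {hub} => -[] [] //= _; rewrite ?mulr0n ?mulr1n; lra.
- by rewrite nbsum_stem0 // !vfun_stem //= t0; move: hub; rewrite -mulr_natl; lra.
- rewrite nbsum_stem // !vfun_stem; [|by lia..].
  by have := tp p pL; lra.
- rewrite nbsum_stemL // !vfun_stem ?leq_pred //= sumr_const card_ord -mulr_natl.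
  by lra.
rewrite nbsum_cliq vfun_stem //= sumr_const cardC1 card_ord -mulr_natl.
have N_gt0 : (0 < N)%N by apply: leq_trans (ltn_ord k).
have -> : N.-1%:R = N%:R - 1 :> R by rewrite -subn1 natrB.
case: a3 hE xA => [[N1 _] | -> _]; last by lra.
rewrite /target /= => /negP[]; apply/or3P; apply: Or33.
apply/eqP; congr inr; apply: val_inj; move: k k0 {N_gt0 tL}.
by rewrite N1 => k k0; rewrite !ord1.
Qed.

(* The number of edges other than those at a leaf. *)
Let m : R := L%:R + N%:R * (N%:R + 1) / 2.

(* The expected time to reach [stem 0] from [stem p]. *)
Definition return_time (p : R) : R := 2 * m * p - p ^+ 2.

(* The solution [X] of the equation at [stem 0] in [hitting_vfun]. *)
Definition hub_time b (both : bool) : R :=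
  if both then m + 2 else if b then 2 / 3 * (2 * m + 5) else 2 * m + 5.

Definition leaves_time b a1 a2 : lvtx L N -> R :=
  let X := hub_time b (a1 && a2) in
  vfun (X + 1) (leaf_time b a1 a2 X) (leaf_time b a2 a1 X)
    (fun p => X + return_time p%:R) (fun=> X + return_time L%:R + N%:R).

Lemma leaves_time_hitting b k0 a1 a2 : a1 || a2 ->
  hitting_time (G := lgraph L N b)
    (target (G := lgraph L N b) (lu L N) (lv L N) (cliq L k0) a1 a2 false)
    (leaves_time b a1 a2).
Proof.
move=> a12; apply: hitting_vfun => //.
- by rewrite /return_time; ring.
- case=> [//|p] _; rewrite /= /return_time -!natr1; ring.
(* The last increment of [return_time] is N (N + 1) + 1, which balances the N clique edges at
   [stem L]. *)
- move: L_gt0; rewrite /return_time /m; case: L => // l _.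
  by rewrite /= -!natr1; field.
rewrite /leaf_time /hub_time /return_time.
by case: a1 a2 a12 b => -[] //= _ []; field.
Qed.

End HittingTimes.

(** * Hitting times on the spider with one long leg *)

Section TipTimes.
Variables (R : realType) (L : nat).
Hypothesis L_gt0 : (0 < L)%N.

Let K : R := L%:R + 1.

Definition tip_hub_time (b a1 a2 : bool) : R :=
  if a1 && a2 then K * (K + 4) / (2 * K + 1)
  else if b then 2 * K * (K + 5) / (3 * K + 2) else K * (K + 5) / (K + 1).

(** The long leg has length [K]. With a leaf among the targets, gambler's ruin on [0, K] gives the
    duration p (K - p) plus X times the probability 1 - p / K of reaching the hub first. With the
    tip alone, the step from p to p + 1 costs 2 (3 + b + p) + 1, twice the number of edges behind
    plus one. *)
Definition tip_time (b a1 a2 : bool) : lvtx L 1 -> R :=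
  if a1 || a2 then
    let X := tip_hub_time b a1 a2 in
    vfun (X + 1) (leaf_time b a1 a2 X) (leaf_time b a2 a1 X)
      (fun p => p%:R * (K - p%:R) + X * (1 - p%:R / K)) (fun=> 0)
  else
    let X := K ^+ 2 + 2 * (3 + b%:R) * K in
    vfun (X + 1) (leaf_time b a1 a2 X) (leaf_time b a2 a1 X)
      (fun p => K ^+ 2 - p%:R ^+ 2 + 2 * (3 + b%:R) * (K - p%:R)) (fun=> 0).

Lemma tip_time_hitting b a1 a2 :
  hitting_time (G := lgraph L 1 b)
    (target (G := lgraph L 1 b) (lu L 1) (lv L 1) (cliq L ord0) a1 a2 true)
    (tip_time b a1 a2).
Proof.
have K0 : 0 < K by rewrite /K ltr_wpDl.
have KE : L.-1%:R = K - 2.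
  by move: L_gt0; rewrite /K; case: L => //= l _; rewrite -natr1; ring.
have LE : L%:R = K - 1 by rewrite /K addrK.
rewrite /tip_time; case: ifP => a12; apply: hitting_vfun => //.
- by field; rewrite gt_eqF.
- case=> [//|p] _; rewrite /= -!natr1; field; by rewrite gt_eqF.
- by rewrite KE LE; field; rewrite gt_eqF.
- rewrite /leaf_time /tip_hub_time.
  by case: a1 a2 a12 b => -[] //= _ []; field; rewrite -/K !gt_eqF //=; lra.
- by ring.
- case=> [//|p] _; rewrite /= -!natr1; ring.
- by rewrite KE LE; ring.
by rewrite /leaf_time; case: a1 a2 a12 b => -[] //= _ [] /=; ring.
Qed.

End TipTimes.

(** * Covering the clique *)

Section Explored.
Variables (L N : nat).
Implicit Types (x y : lvtx L N) (V : {set lvtx L N}).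

(* The stem is visited in order, so a visited clique vertex forces it to be visited. *)
Definition explored x V : Prop :=
  [/\ x \in V, ls L N \in V &
      forall z p, z \in V -> (p.+1 < level z)%N -> stem L N p \in V].

Lemma explored_start : explored (ls L N) [set ls L N].
Proof. by split; rewrite ?inE // => z p; rewrite inE => /eqP->. Qed.

Lemma explored_step b x y V : explored x V -> ladj b x y -> explored y (y |: V).
Proof.
move=> [xV sV Vp] xy; split; rewrite ?inE ?eqxx ?sV ?orbT // => z p.
rewrite !inE => /orP[/eqP-> py | zV /(Vp _ _ zV) ->]; last by rewrite orbT.
(* Only a move to a higher level can ask for a new stem vertex, and that vertex is the position [x]
   just left. *)
have := level_adj xy; rewrite leq_eqVlt => /orP[/eqP yx|]; last first.
  by rewrite ltnS => yx; rewrite (Vp x) ?orbT //; apply: leq_trans py yx.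
move: py; rewrite yx ltnS leq_eqVlt => /orP[/eqP xp|]; last first.
  by move=> px; rewrite (Vp x) ?orbT.
suff <- : x = stem L N p by rewrite xV orbT.
case: x xV Vp xy yx xp => [[i|q]|k] //= _ _ _ yx.
  by move=> [->]; rewrite /stem inord_val.
by case: y yx => [[j|r]|l] //=; [have := ltn_ord r|]; lia.
Qed.

(** Along the walk, the stem is covered as soon as a clique vertex is, so only [lu], [lv] and the
    clique need tracking. *)
Lemma explored_full x V (k0 : 'I_N) : explored x V ->
  lu L N \in V -> lv L N \in V -> (forall k, cliq L k \in V) -> V = setT.
Proof.
move=> [_ sV Vp] uV vV cV; apply/setP; apply: lvtx_ind => [||||p pL||k];
  rewrite inE ?sV ?uV ?vV ?cV // (Vp (cliq L k0)) //=; lia.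
Qed.

End Explored.

(** * A supersolution for covering the clique *)

Section CliqueTime.
Variables (R : realType) (L N : nat).
Hypotheses (L_gt0 : (0 < L)%N) (LN : (2 * L + 7 <= N)%N).
Implicit Types (x y : lvtx L N) (V : {set lvtx L N}).

Definition unvisited V := #|[set k : 'I_N | cliq L k \notin V]|.

(* The exact increments are [(N + beta) / k] with [beta = (2 L + 8) / (N + 1) <= 1];
   replacing them by [(N + 1) / 2] for [k >= 2] keeps a supersolution, and the total,
   of order [N^2 / 2], stays below the gain of order [2 N^2 / 3]. *)
Definition from_clique (k : nat) : R := (N%:R + 1) * (k%:R + 1) / 2.

(** With the edge present, the stem step from p to p + 1 costs 2 p + 9, and these sum to (L - p) (L
    + p + 8); [stem L] gets the value [c + 1]. *)
Definition from_vertex (k : nat) : lvtx L N -> R :=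
  let c := from_clique k in
  let hub := L%:R * (L%:R + 8) + (c + 1) in
  vfun (hub + 1) (hub + 2) (hub + 2)
    (fun p => (L%:R - p%:R) * (L%:R + p%:R + 8) + (c + 1)) (fun=> c).

Definition clique_time x V : R :=
  if unvisited V == 0%N then 0 else from_vertex (unvisited V) x.

Lemma unvisited_inl V z : unvisited ((inl z : lvtx L N) |: V) = unvisited V.
Proof. by apply: eq_card => k; rewrite !inE. Qed.

Lemma unvisited_cliq V k :
  unvisited (cliq L k |: V) = (unvisited V - (cliq L k \notin V))%N.
Proof.
rewrite /unvisited [in RHS](cardsD1 k) inE addKn.
by apply: eq_card => l; rewrite !inE negb_or.
Qed.

Lemma sum_unvisited V :
  \sum_(k < N) (cliq L k \notin V)%:R = (unvisited V)%:R :> R.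
Proof.
rewrite /unvisited -sum1_card natr_sum [RHS]big_mkcond /=.
by apply: eq_bigr => k _; rewrite inE; case: ifP.
Qed.

Definition clique_gain (k : nat) : R :=
  from_clique k - (if k.-1 == 0%N then 0 else from_clique k.-1).

(** This is exactly the supersolution condition at a clique vertex; equality holds for k = 1. *)
Lemma clique_gain_ge k : (0 < k)%N -> N%:R + 1 <= k%:R * clique_gain k.
Proof.
case: k => // -[|k] _; rewrite /clique_gain /from_clique /=; first by lra.
have kN := mulr_ge0 (ler0n R k) (ler0n R N).
have := ler0n R k; have := ler0n R N.
rewrite -[k.+2%:R]natr1 -[k.+1%:R]natr1; lra.
Qed.

Lemma clique_time_cliq V k : (0 < unvisited V)%N ->
  clique_time (cliq L k) (cliq L k |: V) =
  from_clique (unvisited V) - clique_gain (unvisited V) * (cliq L k \notin V)%:R.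
Proof.
rewrite /clique_time unvisited_cliq lt0n => kV.
case: (cliq L k \in V) => /=; first by rewrite subn0 (negPf kV) mulr0 subr0.
by rewrite subn1 mulr1 /clique_gain opprB addrC subrK.
Qed.

Lemma clique_time_drift x V : x \in V ->
  0 <= \sum_(y | ladj true x y)
    (clique_time x V - clique_time y (y |: V) - (0 < unvisited V)%N%:R).
Proof.
move=> xV; have [k0|k_gt0] := posnP (unvisited V).
  rewrite big1 // => y _; rewrite /clique_time k0 eqxx.
  case: y => [z|k]; first by rewrite unvisited_inl k0 eqxx !subr0.
  by rewrite unvisited_cliq k0 sub0n eqxx !subr0.
have inlE y z : y = inl z :> lvtx L N ->
    clique_time y (y |: V) = from_vertex (unvisited V) y.
  by move=> ->; rewrite /clique_time unvisited_inl eqn0Ngt k_gt0.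
rewrite {1}/clique_time; have := k_gt0; rewrite lt0n => /negPf ->.
have gain := clique_gain_ge k_gt0.
have NL : 2 * L%:R + 7 <= N%:R :> R by rewrite -natrM -natrD ler_nat.
move: x xV; apply: lvtx_ind => [||||p pL||k] xV.
- rewrite nbsum_ls (inlE _ _ erefl) /from_vertex vfun_stem //=; lra.
- rewrite nbsum_lu !(inlE _ _ erefl) /from_vertex vfun_stem //=; lra.
- rewrite nbsum_lv !(inlE _ _ erefl) /from_vertex vfun_stem //=; lra.
- rewrite nbsum_stem0 // !(inlE _ _ erefl) /from_vertex !vfun_stem //=; lra.
- rewrite nbsum_stem // !(inlE _ _ erefl) /from_vertex !vfun_stem; [|by lia..].
  by case: p pL xV => // p _ _; rewrite /= -!natr1; lra.
- rewrite nbsum_stemL // (inlE _ _ erefl) /from_vertex !vfun_stem ?leq_pred //.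
  under eq_bigr do rewrite clique_time_cliq //.
  rewrite (eq_bigr (fun i => clique_gain (unvisited V) * (cliq L i \notin V)%:R)).
    (* At [stem L] the backward edge loses 2 L + 8 and the clique gains at least N + 1, whence the
       hypothesis 2 L + 7 <= N. *)
    rewrite -mulr_sumr sum_unvisited.
    have -> : L.-1%:R = L%:R - 1 :> R by rewrite -subn1 natrB.
    by move: gain NL; rewrite /=; lra.
  by move=> i _ /=; ring.
rewrite nbsum_cliq (inlE _ _ erefl) /from_vertex vfun_stem //.
under eq_bigr do rewrite clique_time_cliq //.
rewrite (eq_bigr (fun i => clique_gain (unvisited V) * (cliq L i \notin V)%:R - 1)).
  have := sum_unvisited V; rewrite (bigD1 k) //= xV add0r => sumV.
  rewrite sumrB -mulr_sumr sumV sumr_const cardC1 card_ord -mulr_natl.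
  have -> : N.-1%:R = N%:R - 1 :> R.
    by rewrite -subn1 natrB // (leq_trans _ (ltn_ord k)).
  by move: gain; rewrite /=; lra.
by move=> i _ /=; ring.
Qed.

End CliqueTime.

(** * The effect of the edge *)

(** Once the relations are identified, the graphs differ only in proofs, which are equal by
    irrelevance. *)
Lemma t_cov_eq_adj (R : realType) (T : finType) (e1 e2 : rel T) s1 i1 s2 i2 (s : T) :
  e1 =2 e2 ->
  t_cov R (s : @SGraph T e1 s1 i1) = t_cov R (s : @SGraph T e2 s2 i2).
Proof.
move=> e12; have {}e12 : e1 = e2 by apply/funext => x; apply/funext => y.
by subst e2; rewrite (Prop_irrelevance s1 s2) (Prop_irrelevance i1 i2).
Qed.

Lemma set2_eq (T : finType) (x y u v : T) : x != y ->
  ([set x; y] == [set u; v]) = (x == u) && (y == v) || (x == v) && (y == u).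
Proof.
move=> xy; apply/eqP/orP => [E | [] /andP[/eqP-> /eqP->] //]; last first.
  exact: finset.setUC.
have := set21 x y; have := set22 x y; rewrite E !inE.
case/orP=> /eqP yE /orP[] /eqP xE; move: xy; rewrite xE yE ?eqxx // => _.
  by right.
by left.
Qed.

Section CoverTimes.
Variables (R : realType) (L N : nat).
Hypothesis L_gt0 : (0 < L)%N.
Implicit Types (b : bool) (x y : lvtx L N) (V : {set lvtx L N}).

Lemma t_cov_add_edge :
  @t_cov R (add_edge (cu (lconf L N)) (cv (lconf L N))) (cs (lconf L N)) =
  t_cov R (ls L N : lgraph L N true).
Proof.
apply: t_cov_eq_adj => x y; rewrite /add_adj /=.
have -> : (x != y) && ([set x; y] == [set lu L N; lv L N]) =
    (x == lu L N) && (y == lv L N) || (x == lv L N) && (y == lu L N).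
  case: eqVneq => [->|/set2_eq -> //]; apply/esym/negbTE.
  by apply/negP => /orP[] /andP[/eqP-> ].
case: x y => [[i|p]|k] [[j|q]|l] //=; rewrite ?andbF ?orbF //.
by case: i j => -[|[|[|//]]] i3 [[|[|[|//]]] j3].
Qed.

Definition leaves_cover b (x : lvtx L N) (V : {set lvtx L N}) : R :=
  both_cover (G := lgraph L N b) (lu L N) (lv L N)
  (fun a1 a2 _ => leaves_time R (L := L) (N := N) b a1 a2) x V.

Lemma missing_setT b z : missing R (G := lgraph L N b) setT z = 0.
Proof. by rewrite /missing in_setT. Qed.

Lemma leaves_cover_ls b :
  leaves_cover b (ls L N) [set ls L N] =
  2 * hub_time R L N b false - hub_time R L N b true + 1.
Proof.
rewrite /leaves_cover /both_cover /missing !inE /= /leaves_time /=; ring.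
Qed.

Lemma leaves_cover_drift b (k0 : 'I_N) x V : x \in V ->
  \sum_(y | ladj b x y) (leaves_cover b x V - leaves_cover b y (y |: V)
    - (~~ ((lu L N \in V) && (lv L N \in V)))%:R) = 0.
Proof.
apply: (both_cover_drift (G := lgraph L N b) (e := cliq L k0)) => a1 a2.
exact: leaves_time_hitting.
Qed.

Lemma leaves_cover_setT b x : leaves_cover b x setT = 0.
Proof. by rewrite /leaves_cover /both_cover !missing_setT !mul0r addr0 subr0. Qed.

(** The cover time is at least max(tau_u, tau_v). *)
Lemma leaves_cover_le b (k0 : 'I_N) :
  ((2 * hub_time R L N b false - hub_time R L N b true + 1)%:E
   <= t_cov R (ls L N : lgraph L N b))%E.
Proof.
rewrite -leaves_cover_ls.
apply: (@t_cov_ge R (lgraph L N b) (@no_isolated _ _ L_gt0 _) (fun x V => x \in V)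
  (@leaves_cover b)).
- by move=> x y V _ _; rewrite !inE eqxx.
- by rewrite inE.
- by move=> x _; rewrite leaves_cover_setT.
move=> x V xV _; rewrite -[leRHS](leaves_cover_drift b k0 xV).
by apply: ler_sum => y _; rewrite lerD2l lerN2 lern1 leq_b1.
Qed.

(** The cover time is at most max(tau_u, tau_v) plus the clique's cover time: while some vertex is
    unvisited, at least one of the two clocks runs. *)
Lemma t_cov_added_le (k0 : 'I_N) : (2 * L + 7 <= N)%N ->
  (t_cov R (ls L N : lgraph L N true) <=
   (2 * hub_time R L N true false - hub_time R L N true true + 1
    + clique_time R (ls L N) [set ls L N])%:E)%E.
Proof.
move=> LN; rewrite -leaves_cover_ls.
apply: (@t_cov_le R (lgraph L N true) (@no_isolated _ _ L_gt0 _) (@explored L N)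
  (fun x V => leaves_cover true x V + clique_time R x V)).
- exact: explored_step.
- exact: explored_start.
- move=> x _; rewrite leaves_cover_setT add0r /clique_time.
  rewrite (_ : unvisited _ = 0%N) //.
  by apply/eqP; rewrite cards_eq0; apply/eqP/setP => k; rewrite !inE.
move=> x V exV VT; have [xV _ _] := exV.
have bd := leaves_cover_drift true k0 xV.
have cd := clique_time_drift R L_gt0 LN xV.
apply: le_trans cd _; rewrite -[leLHS]add0r -[X in X + _ <= _]bd.
rewrite -big_split /=; apply: ler_sum => y _.
suff : 1 <= (~~ ((lu L N \in V) && (lv L N \in V)))%:R
          + (0 < unvisited V)%N%:R :> R by lra.
rewrite -natrD ler1n; have [/andP[uV vV]|//] := boolP (_ && _).
rewrite add0n lt0b lt0n; apply: contraNneq VT => /cards0_eq unv.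
rewrite (explored_full k0 exV) // => k; apply: contraT => kV.
by have := finset.in_set0 k; rewrite -unv inE kV.
Qed.

End CoverTimes.

(** * Cover time of the spider *)

Section TipCoverTimes.
Variables (R : realType) (L : nat).
Hypothesis L_gt0 : (0 < L)%N.
Implicit Types (b : bool) (x y : lvtx L 1) (V : {set lvtx L 1}).

Let K : R := L%:R + 1.

Definition tip_cover b (x : lvtx L 1) (V : {set lvtx L 1}) : R :=
  extra_cover (G := lgraph L 1 b) (lu L 1) (lv L 1) (cliq L ord0)
    (fun a1 a2 _ => tip_time R (L := L) b a1 a2) x V.

Lemma tip_cover_ls b :
  tip_cover b (ls L 1) [set ls L 1] =
  K ^+ 2 + 2 * (3 + b%:R) * K
  - 2 * tip_hub_time R L b true false + tip_hub_time R L b true true.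
Proof.
rewrite /tip_cover /extra_cover /missing !inE /= /tip_time /=.
rewrite /tip_hub_time -/K /=; ring.
Qed.

Lemma tip_cover_drift b x V : x \in V ->
  \sum_(y | ladj b x y) (tip_cover b x V - tip_cover b y (y |: V)
    - [&& lu L 1 \in V, lv L 1 \in V & cliq L ord0 \notin V]%:R) = 0.
Proof.
apply: (extra_cover_drift (G := lgraph L 1 b)) => a1 a2.
exact: tip_time_hitting.
Qed.

(** The full inclusion-exclusion formula for the maximum of the hitting times of [lu], [lv] and the
    tip. *)
Definition path_cover b x V := leaves_cover R b x V + tip_cover b x V.

Lemma path_cover_setT b x : path_cover b x setT = 0.
Proof.
rewrite /path_cover leaves_cover_setT /tip_cover /extra_cover !missing_setT.
by rewrite !mul0r !subr0 !addr0.
Qed.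

Lemma path_cover_drift b x V : x \in V ->
  \sum_(y | ladj b x y) (path_cover b x V - path_cover b y (y |: V)
    - (~~ [&& lu L 1 \in V, lv L 1 \in V & cliq L ord0 \in V])%:R) = 0.
Proof.
move=> xV.
have := congr2 +%R (leaves_cover_drift R L_gt0 b ord0 xV) (tip_cover_drift b xV).
rewrite addr0 => E; rewrite -[RHS]E -big_split /=; apply: eq_bigr => y _.
rewrite /path_cover.
by case: (lu _ _ \in V); case: (lv _ _ \in V); case: (cliq _ _ \in V) => /=; ring.
Qed.

Lemma t_cov_path_ge :
  ((path_cover true (ls L 1) [set ls L 1])%:E
   <= t_cov R (ls L 1 : lgraph L 1 true))%E.
Proof.
apply: (@t_cov_ge R (lgraph L 1 true) (@no_isolated _ _ L_gt0 _)
  (fun x V => x \in V) (@path_cover true)).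
- by move=> x y V _ _; rewrite !inE eqxx.
- by rewrite inE.
- by move=> x _; rewrite path_cover_setT.
move=> x V xV _; rewrite -[leRHS](path_cover_drift true xV).
by apply: ler_sum => y _; rewrite lerD2l lerN2 lern1 leq_b1.
Qed.

Lemma t_cov_path_le :
  (t_cov R (ls L 1 : lgraph L 1 false)
   <= (path_cover false (ls L 1) [set ls L 1])%:E)%E.
Proof.
apply: (@t_cov_le R (lgraph L 1 false) (@no_isolated _ _ L_gt0 _)
  (@explored L 1) (@path_cover false)).
- exact: explored_step.
- exact: explored_start.
- by move=> x _; rewrite path_cover_setT.
move=> x V exV VT; have [xV _ _] := exV.
rewrite -[leLHS](path_cover_drift false xV).
apply: ler_sum => y _; rewrite lerD2l lerN2.
have [/and3P[uV vV eV]|//] := boolP [&& _, _ & _].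
case/eqP: VT; apply: (explored_full ord0 exV) => // k.
by rewrite ord1.
Qed.

Lemma path_cover_lt :
  path_cover false (ls L 1) [set ls L 1] < path_cover true (ls L 1) [set ls L 1].
Proof.
rewrite /path_cover !leaves_cover_ls !tip_cover_ls /hub_time /tip_hub_time /= -/K.
have K2 : 2 <= K by rewrite (_ : 2 = 1 + 1) // lerD2r ler1n.
have -> : L%:R = K - 1 by rewrite /K addrK.
move: (K) K2 => k k2; rewrite -subr_gt0; set d := (X in 0 < X).
have -> : d = 2 * (12 * k ^+ 3 + 10 * k ^+ 2 - 46 * k - 20)
    / (6 * ((3 * k + 2) * (k + 1))).
  by rewrite /d; field; rewrite !gt_eqF //=; lra.
apply: divr_gt0; last by rewrite !mulr_gt0 //; lra.
(* In powers of j = k - 2 the cubic is 12 j^3 + 82 j^2 + 138 j + 24. *)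
have k0 : 0 <= k - 2 by rewrite subr_ge0.
have := mulr_ge0 k0 k0; have := mulr_ge0 (mulr_ge0 k0 k0) k0.
by lra.
Qed.

End TipCoverTimes.

(** * The two signs and the conclusion *)

Lemma delta_gt0 (R : realType) L : (0 < L)%N -> (0 < delta R (lconf L 1))%E.
Proof.
move=> L0; rewrite /delta t_cov_add_edge sube_gt0.
apply: le_lt_trans (t_cov_path_le R L0) _.
apply: lt_le_trans (t_cov_path_ge R L0).
by rewrite lte_fin path_cover_lt.
Qed.

Lemma delta_lt0 (R : realType) L : (0 < L)%N ->
  (delta R (lconf L (4 * L + 7)) < 0)%E.
Proof.
move=> L0; rewrite /delta t_cov_add_edge.
set N := (4 * L + 7)%N.
have k0 : 'I_N by rewrite /N addnS; exact: ord0.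
have lo b := leaves_cover_le R L0 b k0.
have hi := t_cov_added_le R L0 k0 (leq_add (leq_mul (isT : 2 <= 4)%N (leqnn L)) (leqnn 7)).
set c := (X in (_ <= X%:E)%E) in hi.
(* Finiteness of one term permits comparing the difference of extended reals with 0. *)
have t_fin : t_cov R (ls L N : lgraph L N true) \is a fin_num.
  by rewrite fin_numElt (lt_le_trans (ltNyr _) (lo true)) (le_lt_trans hi) ?ltry.
rewrite subre_lt0 //; apply: le_lt_trans hi (lt_le_trans _ (lo false)).
rewrite lte_fin /c /hub_time /clique_time.
have -> : unvisited [set ls L N] = N.
  rewrite -[RHS]card_ord -cardsT; congr #|pred_of_set _|.
  by apply/setP => k; rewrite !inE.
have -> : (N == 0)%N = false by rewrite /N addnS.
rewrite /from_vertex /from_clique /= /N natrD natrM.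
have L2 := mulr_ge0 (ler0n R L) (ler0n R L).
(* For N = 4 L + 7 the lower bound without the edge exceeds the upper bound with it by 5/3 L^2 + 4/3
   L + 20/3. *)
by have := ler0n R L; lra.
Qed.

Theorem theorem1p1 (R : realType) (r : nat) (hr : (1 <= r)%N) :
  exists Gm Gp : config,
    [/\ graph_connected Gm /\ graph_connected Gp,
        nonedge (cu Gm) (cv Gm) /\ nonedge (cu Gp) (cv Gp),
        isomorphic (local_datum r Gm) (local_datum r Gp),
        (0 < delta R Gp)%E /\ (delta R Gm < 0)%E
      & forall C : config, C = Gm \/ C = Gp ->
          [/\ deg (cs C) = 1%N, deg (cu C) = 1%N, deg (cv C) = 1%N,
              gdist_set (cs C) [set cu C; cv C] = 2%N
            & eff_res R (cu C) (cv C) = 2]].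
Proof.
(* Both stems have length r; only the clique size differs. *)
exists (lconf r (4 * r + 7)), (lconf r 1); split.
- by split; apply: lgraph_connected.
- by split; apply: lu_lv_nonedge.
- exact: local_datum_lconf.
- by split; [apply: delta_gt0 | apply: delta_lt0].
move=> C; case=> ->; split.
- exact: deg_ls.
- exact: deg_lu.
- exact: deg_lv.
- exact: gdist_set_ls.
- exact: eff_res_lconf.
- exact: deg_ls.
- exact: deg_lu.
- exact: deg_lv.
- exact: gdist_set_ls.
exact: eff_res_lconf.
Qed.
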